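(* Let $n\geq 0$. Every strictly convex polygon with $2n+2$ vertices has exactly $\binom{2n}{n}^2\frac{1}{n+1}$ fair triangulations.
   Context: A triangulation of a strictly convex polygon is a decomposition of it into non-overlapping triangles whose vertices are vertices of the polygon (a polygon with $m+2$ vertices is decomposed into $m$ triangles). A checkerboard colouring of a triangulation colours every triangle black or white so that triangles sharing an edge have different colours; such a colouring exists and is unique up to exchanging the two colours. A triangulation is called fair if its checkerboard colourings involve the same number of black and white triangles. *)

(* Defs.v *)
From mathcomp Require Import all_boot all_order all_algebra.
From mathcomp Require Import boolp classical_sets reals topology normedtype.

Set Implicit Arguments.
Unset Strict Implicit.
Unset Printing Implicit Defensive.

Import Order.TTheory GRing.Theory Num.Theory.
Import numFieldNormedType.Exports.

Local Open Scope ring_scope.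

Definition hull (R : realType) (N : nat) (p : 'I_N -> 'rV[R]_2)
    (A : {set 'I_N}) : set 'rV[R]_2 :=
  [set x | exists w : 'I_N -> R,
    [/\ forall i, 0 <= w i, \sum_(i in A) w i = 1
      & x = \sum_(i in A) w i *: p i]]%classic.

(* A strictly convex polygon is given by its vertices, listed in any order:
   N points none of which lies in the convex hull of the others (so that they
   are the N distinct extreme points of their hull).  The polygon, as a region
   of the plane, is [hull p [set: 'I_N]]. *)
Definition strictly_convex (R : realType) (N : nat) (p : 'I_N -> 'rV[R]_2)
    : Prop :=
  forall i, ~ hull p [set~ i] (p i).

(* A triangle is encoded by its set of three vertex indices.  The polygon with
   two vertices is a digon, which bounds no region: it is decomposed into no
   triangles, hence the guard in the last clause. *)
Definition triangulation (R : realType) (N : nat) (p : 'I_N -> 'rV[R]_2)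
    (T : {set {set 'I_N}}) : Prop :=
  [/\ forall t, t \in T -> #|t| = 3%N,
      forall t u, t \in T -> u \in T -> t != u ->
        (interior (hull p t) `&` interior (hull p u) = set0)%classic
    & (2 < N)%N ->
        (\bigcup_(t in [set` T]) hull p t)%classic = hull p [set: 'I_N]].

(* Two distinct triangles share an edge when they have two common vertices. *)
Definition checkerboard (N : nat) (T : {set {set 'I_N}})
    (black : {set 'I_N} -> bool) : Prop :=
  forall t u, t \in T -> u \in T -> #|t :&: u| = 2%N -> black t != black u.

Definition fair (N : nat) (T : {set {set 'I_N}}) : Prop :=
  forall black : {set 'I_N} -> bool, checkerboard T black ->
    #|[set t in T | black t]| = #|[set t in T | ~~ black t]|.

Definition fair_triangulations (R : realType) (N : nat)
    (p : 'I_N -> 'rV[R]_2) : {set {set {set 'I_N}}} :=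
  [set T : {set {set 'I_N}} | `[< triangulation p T /\ fair T >]].

(* Main.v *)
Require Import Defs.
From HB Require Import structures.
From mathcomp Require Import boolp classical_sets reals topology normedtype.
From mathcomp Require Import all_boot all_order all_algebra.
From mathcomp Require Import fingroup perm.
From mathcomp Require Import ring lra zify.

Set Implicit Arguments.
Unset Strict Implicit.
Unset Printing Implicit Defensive.

Import Order.TTheory GRing.Theory Num.Theory.

Local Open Scope ring_scope.

(* After sorting the vertices counterclockwise, the triangle of a triangulation
   resting on the edge joining the first and the last vertex splits it into two
   smaller triangulations, so triangulations of a polygon with [m + 2] vertices
   are binary trees with [m] nodes, and the checkerboard colouring is the parity
   of the depth.  Let [f] and [g] be the generating functions, in the numbers
   [a] of black and [b] of white nodes, of the trees with black, resp. white,
   root, so that [f = 1 + x g^2] and [g = 1 + y f^2].  The equations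
   [f^(k+1) g^l = f^k g^l + x f^k g^(l+2)], and symmetrically in [g], determine
   all coefficients of all [f^k g^l]; the formula of Lagrange and Good, here
   [forests k l a b], satisfies them by Pascal's rule. *)

(** * Counting binary trees by depth parity *)

(** The subtracted product in [forests] is the Jacobian term of Good's formula: with [u = f - 1] and
    [v = g - 1], so that [u = x (1 + v)^2] and [v = y (1 + u)^2], the determinant is
    [1 - 4 u v / ((1 + u) (1 + v))], and the 4 comes from the two squares. All [f^k g^l] are treated
    at once because the equation for [f] leads to [g^2] and does not close up on its own. On the
    geometric side, [triangulation] speaks only of interiors and of a union of hulls, so the tree
    has to be extracted from these: a point of the polygon close to an edge detects the triangle
    resting on it, and crossing edges force interiors to overlap. Fairness ranges over all
    checkerboard colourings. Each is forced by the colour of the top triangle, but one must also be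
    exhibited, since otherwise an unbalanced triangulation could be fair vacuously. *)

Definition forests (k l a b : nat) : int :=
  ('C(k + 2 * b, a) * 'C(l + 2 * a, b))%N%:Z -
  (if a is a'.+1 then if b is b'.+1
   then 4 * ('C(k + 2 * b' + 1, a') * 'C(l + 2 * a' + 1, b'))%N else 0 else 0)%N%:Z.

Lemma forestsC k l a b : forests k l a b = forests l k b a.
Proof.
rewrite /forests mulnC; congr (_ - _).
by case: a b => [|a] [|b] //; rewrite (mulnC 'C(k + _ + 1, a)).
Qed.

Lemma forests0S k l b : forests k.+1 l 0 b = forests k l 0 b.
Proof. by rewrite /forests !bin0. Qed.

Lemma forestsS k l a b :
  forests k.+1 l a.+1 b = forests k l a.+1 b + forests k l.+2 a b.
Proof.
rewrite /forests.
have -> : (l.+2 + 2 * a = l + 2 * a.+1)%N by lia.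
rewrite [(k.+1 + 2 * b)%N]addSn binS.
case: b => [|b]; first by case: a => [|a]; rewrite !mulnDl PoszD; ring.
have -> : (k.+1 + 2 * b + 1 = (k + 2 * b + 1).+1)%N by lia.
case: a => [|a]; first by rewrite !bin0 !mulnDl !PoszD; ring.
have -> : (l.+2 + 2 * a + 1 = l + 2 * a.+1 + 1)%N by lia.
by rewrite binS; lia.
Qed.

(** These are the coefficients of [f^0 g^0 = 1]. For positive indices the absorption identity
    [m C(n, m) = n C(n - 1, m - 1)], applied to both factors, makes the two products cancel. *)
Lemma forests00 a b : forests 0 0 a b = ((a == 0) && (b == 0))%N%:Z.
Proof.
case: a b => [|a] [|b] //; rewrite /forests ?muln0 ?mul0n ?bin0n ?muln0 //=.
rewrite !add0n.
have Ha := mul_bin_diag (2 * b + 1).+1 a; have Hb := mul_bin_diag (2 * a + 1).+1 b.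
have Ea : (2 * b.+1 = (2 * b + 1).+1)%N by lia.
have Eb : (2 * a.+1 = (2 * a + 1).+1)%N by lia.
rewrite {}Ea {}Eb; move: Ha Hb => /=.
move: 'C(_, _) 'C(_, _) 'C(_, _) 'C(_, _) => A A' B B' Ha Hb.
apply/eqP; rewrite subr_eq0 /=; apply/eqP; congr Posz.
apply/eqP; rewrite -(eqn_pmul2l (ltn0Sn a)) -(eqn_pmul2l (ltn0Sn b)); apply/eqP.
transitivity ((a.+1 * B) * (b.+1 * A))%N; first by ring.
by rewrite -Ha -Hb; ring.
Qed.

(** Multiplication of [f^k g^l] by [f^k' g^l'], by induction on [a + b], then on [k + l]: lowering
    [k] leaves one term with smaller [k + l] and one with larger [l] but smaller [a]. *)
Lemma forests_conv k l k' l' a b :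
  \sum_(i < a.+1) \sum_(j < b.+1) forests k l i j * forests k' l' (a - i) (b - j)
  = forests (k + k') (l + l') a b.
Proof.
have [s] := ubnP (a + b); elim: s => // s IHs in k l k' l' a b *.
have [r] := ubnP (k + l); elim: r => // r IHr in k l k' l' a b *.
have step k1 l1 k1' l1' a1 b1 : (k1.+1 + l1 < r.+1)%N -> (a1 + b1 < s.+1)%N ->
  \sum_(i < a1.+1) \sum_(j < b1.+1)
    forests k1.+1 l1 i j * forests k1' l1' (a1 - i) (b1 - j)
  = forests (k1.+1 + k1') (l1 + l1') a1 b1.
  move=> le_r le_s; rewrite addSn.
  case: a1 le_s => [|a1] le_s.
    rewrite big_ord1.
    under eq_bigr => j _ do rewrite forests0S.
    by rewrite forests0S -IHr // big_ord1.
  rewrite big_ord_recl.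
  under eq_bigr => j _ do rewrite forests0S.
  under [X in _ + X]eq_bigr => i _.
    under eq_bigr => j _ do rewrite lift0 forestsS mulrDl subSS.
    rewrite big_split /=.
    over.
  rewrite big_split /= addrA forestsS -(IHr k1 l1) // -(IHs k1 l1.+2) //.
  by rewrite [in RHS]big_ord_recl.
case: k => [|k]; last exact: step.
case: l => [|l] le_r le_s.
  rewrite big_ord_recl [X in _ + X]big1 => [|i _]; last first.
    by rewrite big1 // => j _; rewrite forests00 /= mul0r.
  rewrite big_ord_recl [X in _ * _ + X]big1 => [|j _]; last by rewrite forests00 /= mul0r.
  by rewrite forests00 /= !subn0 mul1r !addr0 !add0n.
(* Exchanging the two colours turns a positive [l] into a positive [k]. *)
rewrite exchange_big forestsC -step 1?addnC ?[(b + a)%N]addnC //.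
by apply: eq_bigr => j _; apply: eq_bigr => i _; rewrite forestsC (forestsC k').
Qed.

(** * Binary trees with prescribed numbers of nodes of each colour *)

Inductive btree := Leaf | Node of btree & btree.

(* The number of nodes coloured [true] when the root is coloured [c] and the
   colours alternate along the edges. *)
Fixpoint nodes (c : bool) (t : btree) : nat :=
  if t is Node l r then c + (nodes (~~ c) l + nodes (~~ c) r) else 0.

Fixpoint btree_eq (s t : btree) : bool :=
  match s, t with
  | Leaf, Leaf => true
  | Node s1 s2, Node t1 t2 => btree_eq s1 t1 && btree_eq s2 t2
  | _, _ => false
  end.

Lemma btree_eqP : Equality.axiom btree_eq.
Proof.
elim=> [|s1 IH1 s2 IH2] [|t1 t2] /=; try by constructor.
by apply: (iffP andP) => [[/IH1-> /IH2->]|[<- <-]] //; split; [apply/IH1|apply/IH2].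
Qed.

HB.instance Definition _ := hasDecEq.Build btree btree_eqP.

Definition rect (a b : nat) : seq (nat * nat) :=
  [seq (i, j) | i <- iota 0 a, j <- iota 0 b].

Lemma mem_rect a b i j : ((i, j) \in rect a b) = (i < a)%N && (j < b)%N.
Proof.
apply/allpairsP/andP => [[[i1 j1] [Hi Hj [-> ->]]]|[lt_i lt_j]].
  by move: Hi Hj; rewrite !mem_iota.
by exists (i, j); split; rewrite ?mem_iota.
Qed.

Lemma uniq_rect a b : uniq (rect a b).
Proof. by apply: allpairs_uniq; rewrite ?iota_uniq // => -[? ?] [? ?] _ _ [-> ->]. Qed.

(* The fuel [d] bounds the number [a + b] of nodes. *)
Fixpoint btrees_rec (d a b : nat) : seq btree :=
  if a is a'.+1 then
    if d is d'.+1 then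
      flatten [seq [seq Node l r | l <- btrees_rec d' ij.2 ij.1,
                                   r <- btrees_rec d' (b - ij.2) (a' - ij.1)]
              | ij <- rect a b.+1]
    else [::]
  else if b == 0 then [:: Leaf] else [::].

Definition btrees (a b : nat) := btrees_rec (a + b) a b.

Lemma btrees_recS d a b : btrees_rec d.+1 a.+1 b =
  flatten [seq [seq Node l r | l <- btrees_rec d ij.2 ij.1,
                               r <- btrees_rec d (b - ij.2) (a - ij.1)]
          | ij <- rect a.+1 b.+1].
Proof. by []. Qed.

Lemma mem_btrees_rec d a b t : (a + b <= d)%N ->
  (t \in btrees_rec d a b) = (nodes true t == a) && (nodes false t == b).
Proof.
elim: d => [|d IHd] in a b t *.
  by case: a b => [|a] [|b] // _; case: t.
case: a => [|a] le_d; first by case: b {le_d} => [|b]; case: t => [|l r] //=; rewrite eq_sym.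
rewrite btrees_recS; apply/idP/idP.
  case/flatten_mapP => -[i j]; rewrite mem_rect => /andP[Hi Hj].
  case/allpairsP => -[l r] /= [Hl Hr ->].
  move: Hl Hr; rewrite !IHd /=; lia.
case: t => [|l r]; first by [].
case/andP => /eqP Ea /eqP Eb; rewrite /= in Ea Eb.
(* The root of [l] has the opposite colour, so the nodes of [l] coloured like the root of the whole
   tree are counted by [nodes false l]. *)
apply/flatten_mapP; exists (nodes false l, nodes true l); first by rewrite mem_rect; lia.
apply/allpairsP; exists (l, r); split=> //=; rewrite IHd; lia.
Qed.

Lemma uniq_flatten_map (S T : eqType) (F : S -> seq T) (s : seq S) :
  uniq s -> (forall x, x \in s -> uniq (F x)) ->
  (forall x y z, x \in s -> y \in s -> z \in F x -> z \in F y -> x = y) ->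
  uniq (flatten (map F s)).
Proof.
elim: s => //= x s IHs /andP[x's Us] UF FI; rewrite cat_uniq UF ?mem_head //=.
rewrite IHs // => [|y s_y|y1 y2 z sy1 sy2]; last first.
- by apply: FI; rewrite inE ?sy1 ?sy2 orbT.
- by apply: UF; rewrite inE s_y orbT.
rewrite andbT; apply/hasPn => z /flatten_mapP[y s_y Fy_z].
apply: contra x's => Fx_z; rewrite (FI x y z) ?mem_head // inE s_y orbT //.
Qed.

(** The left subtree determines the index pair, so distinct pairs yield disjoint blocks. *)
Lemma uniq_btrees_rec d a b : (a + b <= d)%N -> uniq (btrees_rec d a b).
Proof.
elim: d a b => [|d IHd] [|a] b; [by case: b | by [] | by case: b |] => le_d.
rewrite btrees_recS; apply: uniq_flatten_map; first exact: uniq_rect.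
  move=> [i j]; rewrite mem_rect => /andP[Hi Hj].
  by apply: allpairs_uniq => [||[? ?] [? ?] _ _ [-> ->]] //; apply: IHd => /=; lia.
move=> [i j] [i1 j1] z; rewrite !mem_rect => /andP[Hi Hj] /andP[Hi1 Hj1].
move=> /allpairsP[[l r] /= [Hl _ ->]] /allpairsP[[l1 r1] /= [Hl1 _ [El _]]].
move: Hl Hl1; rewrite -{}El !mem_btrees_rec; try lia.
by move=> /andP[/eqP <- /eqP <-] /andP[/eqP-> /eqP->].
Qed.

Lemma size_btrees_rec d a b : (a + b <= d)%N ->
  (size (btrees_rec d a b))%:Z = forests 1 0 a b.
Proof.
elim: d => [|d IHd] in a b *.
  by case: a b => [|a] [|b].
case: a => [|a] le_d.
  by rewrite forests0S forests00; case: b {le_d}.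
(* This is [f = 1 + x g^2], with [g^2] expanded as a convolution, one factor [g] for each
   subtree. *)
rewrite forestsS forests00 add0r -(forests_conv 0 1 0 1).
rewrite btrees_recS size_flatten /shape sumnE !big_map big_allpairs.
under eq_bigr => i _ do under eq_bigr => j _ do rewrite size_allpairs.
rewrite -[iota 0 a.+1]/(index_iota 0 a.+1) -[iota 0 b.+1]/(index_iota 0 b.+1).
rewrite big_mkord raddf_sum /=; apply: eq_bigr => i _.
rewrite big_mkord raddf_sum /=; apply: eq_bigr => j _.
have := ltn_ord i; have := ltn_ord j => lt_j lt_i.
rewrite PoszM !IHd 1?[forests 0 1 _ _]forestsC 1?[forests 0 1 _ (b - j)]forestsC //; lia.
Qed.

(** For positive [n] put [m = C(2n, n)] and [x = C(2n, n - 1)]. Since [m = 2 C(2n - 1, n - 1)], the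
    coefficient is [(m + x) m - 2 x m = m (m - x)], and [m - x = m / (n + 1)] is the Catalan
    number. *)
Lemma forests_diag n :
  (forests 1 0 n n)%:~R = 'C(2 * n, n)%:R ^+ 2 * (1 / (n%:R + 1)) :> rat.
Proof.
rewrite /forests; case: n => [|n]; first by rewrite /= !bin0; field.
rewrite !addn1 !add0n add1n binS.
have hM : 'C(2 * n.+1, n.+1) = (2 * 'C((2 * n).+1, n))%N.
  have -> : (2 * n.+1 = (2 * n).+2)%N by lia.
  by rewrite binS -(@bin_sub _ n) 1?(_ : (2 * n).+1 - n = n.+1)%N; lia.
have := mul_bin_left (2 * n.+1) n; rewrite (_ : 2 * n.+1 - n = n.+2)%N; last by lia.
rewrite (_ : (1 + 2 * n).+1 = 2 * n.+1)%N; last by lia.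
move/(congr1 (fun k => k%:R : rat)); rewrite hM !natrM => hD.
rewrite rmorphB /= -!pmulrn !natrM natrD natrM.
move: hD; set x := ('C(2 * n.+1, n)%:R : rat); set y := ('C(_, n)%:R : rat).
rewrite -[n.+2%:R]natr1 -[n.+1%:R]natr1 => hD.
have n2 : n%:R + 1 + 1 != 0 :> rat by rewrite !natr1 pnatr_eq0.
have -> : x = (n%:R + 1) * (2 * y) / (n%:R + 1 + 1) by rewrite hD mulrC mulKf.
by field.
Qed.

(** * Triangulations from binary trees *)

Section Combinatorics.
Local Open Scope nat_scope.

Fixpoint bsize (t : btree) : nat :=
  if t is Node l r then (bsize l + bsize r).+1 else 0.

Lemma bsizeE c t : bsize t = nodes c t + nodes (~~ c) t.
Proof. by elim: t c => //= l IHl r IHr c; rewrite (IHl c) (IHr c); case: c => /=; lia. Qed.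

Variable M : nat.
Implicit Types (i j k : nat) (x : 'I_M.+2) (u v : {set 'I_M.+2}).

Definition vertices i j : {set 'I_M.+2} := [set x : 'I_M.+2 | i <= x <= j].

(** Indices are natural numbers to keep their arithmetic simple; [inord] sends an index above [M.+1]
    to vertex 0, hence the bounds carried by the lemmas. *)
Definition tri i k j : {set 'I_M.+2} := [set inord i; inord k; inord j].

Lemma in_tri i k j x : i <= M.+1 -> k <= M.+1 -> j <= M.+1 ->
  (x \in tri i k j) = [|| x == i :> nat, x == k :> nat | x == j :> nat].
Proof. by move=> hi hk hj; rewrite !inE -!val_eqE /= !inordK // orbA. Qed.

Lemma card_tri i k j : i < k -> k < j -> j <= M.+1 -> #|tri i k j| = 3.
Proof.
move=> ik kj jM; rewrite /tri -setUA cardsU1 cards2 !inE -!val_eqE /= !inordK; lia.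
Qed.

Lemma arc_sub i j i' j' : i' <= i -> j <= j' -> vertices i j \subset vertices i' j'.
Proof. by move=> hi hj; apply/subsetP => x; rewrite !inE; lia. Qed.

Lemma card_arcI i k j : #|vertices i k :&: vertices k j| <= 1.
Proof.
apply/card_le1P => x; rewrite !inE => hx y.
by rewrite !inE -val_eqE /=; lia.
Qed.

(** A triangle has three vertices and an edge two, so neither can lie on both sides of the vertex
    [k]. *)
Lemma card_subI_arcs i k j u v : u \subset vertices i k -> v \subset vertices k j ->
  #|u :&: v| <= 1.
Proof.
by move=> su sv; apply: leq_trans (card_arcI i k j); apply/subset_leq_card/setISS.
Qed.

(** The tree fills the polygon on the vertices from [i] to [i + bsize t + 1], whose base joins these
    two; a leaf is a bare edge. The apex is where the polygon of [l] ends and that of [r] begins. *)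
Fixpoint tri_of (t : btree) i : {set {set 'I_M.+2}} :=
  if t is Node l r then
    tri i (i + bsize l).+1 (i + bsize t).+1 |:
      (tri_of l i :|: tri_of r (i + bsize l).+1)
  else set0.

Definition top (t : btree) i : {set 'I_M.+2} :=
  if t is Node l r then tri i (i + bsize l).+1 (i + bsize t).+1 else set0.

Lemma tri_of_arc t i u : i + bsize t <= M -> u \in tri_of t i ->
  u \subset vertices i (i + bsize t).+1.
Proof.
elim: t i => [|l IHl r IHr] i /= hM; first by rewrite inE.
rewrite !inE => /or3P[/eqP->|ul|ur].
- by apply/subsetP => x; rewrite in_tri ?inE; lia.
- by apply: subset_trans (IHl _ _ ul) (arc_sub _ _); lia.
- by apply: subset_trans (IHr _ _ ur) (arc_sub _ _); lia.
Qed.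

Lemma card_tri_of t i u : i + bsize t <= M -> u \in tri_of t i -> #|u| = 3.
Proof.
elim: t i => [|l IHl r IHr] i /= hM; first by rewrite inE.
rewrite !inE => /or3P[/eqP->|ul|ur].
- by apply: card_tri; lia.
- by apply: IHl ul; lia.
- by apply: IHr ur; lia.
Qed.

(** The left part misses the last vertex of the base, the right part the first. *)
Lemma tri_of_top t i u : i + bsize t <= M -> u \in tri_of t i ->
  inord i \in u -> inord (i + bsize t).+1 \in u -> u = top t i.
Proof.
case: t => [|l r] /= hM; first by rewrite inE.
rewrite !inE => /or3P[/eqP-> //|ul|ur] ui uj.
- have /subsetP/(_ _ uj) : u \subset vertices i (i + bsize l).+1.
    by apply: tri_of_arc ul; lia.
  by rewrite inE inordK; lia.
- have /subsetP/(_ _ ui) :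
      u \subset vertices (i + bsize l).+1 ((i + bsize l).+1 + bsize r).+1.
    by apply: tri_of_arc ur; lia.
  by rewrite inE inordK; lia.
Qed.

Lemma top_notin_left l r i : i + bsize (Node l r) <= M ->
  top (Node l r) i \notin tri_of l i.
Proof.
move=> /= hM; apply/negP => /tri_of_arc => /(_ ltac:(lia))/subsetP.
by move/(_ (inord (i + (bsize l + bsize r).+1).+1)); rewrite !inE !inordK ?eqxx ?orbT; lia.
Qed.

Lemma top_notin_right l r i : i + bsize (Node l r) <= M ->
  top (Node l r) i \notin tri_of r (i + bsize l).+1.
Proof.
move=> /= hM; apply/negP => /tri_of_arc => /(_ ltac:(lia))/subsetP.
by move/(_ (inord i)); rewrite !inE !inordK ?eqxx ?orbT; lia.
Qed.

Lemma card_left_right l r i u v : i + bsize (Node l r) <= M ->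
  u \in tri_of l i -> v \in tri_of r (i + bsize l).+1 -> #|u :&: v| <= 1.
Proof.
move=> /= hM ul vr; apply: (@card_subI_arcs i (i + bsize l).+1).
  by apply: tri_of_arc ul; lia.
by apply: tri_of_arc vr; lia.
Qed.

Lemma disjoint_left_right l r i : i + bsize (Node l r) <= M ->
  [disjoint tri_of l i & tri_of r (i + bsize l).+1].
Proof.
move=> hM; rewrite disjoint_subset; apply/subsetP => u ul; rewrite inE.
apply/negP => ur; have := card_left_right hM ul ur.
by rewrite setIid (card_tri_of _ ul) //=; move: hM => /=; lia.
Qed.

Lemma tri_of_left l r i : i + bsize (Node l r) <= M ->
  tri_of l i = [set u in tri_of (Node l r) i | u \subset vertices i (i + bsize l).+1].
Proof.
move=> hM; apply/setP => u; rewrite in_set /= !inE.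
have hM' := hM; rewrite /= in hM'.
apply/idP/andP => [ul|[/or3P[/eqP->|//|ur] us]].
- by rewrite ul orbT; split=> //; apply: tri_of_arc ul; lia.
- move/subsetP: us => /(_ (inord (i + (bsize l + bsize r).+1).+1)).
  by rewrite !inE !inordK ?eqxx ?orbT; lia.
- have ur' : u \subset vertices (i + bsize l).+1 ((i + bsize l).+1 + bsize r).+1.
    by apply: tri_of_arc ur; lia.
  have := card_subI_arcs us ur'; rewrite setIid (card_tri_of _ ur) //; lia.
Qed.

(** The upper end [M.+1] keeps [r] out of the filtering condition, so trees whose left subtrees have
    equal size are filtered alike. *)
Lemma tri_of_right l r i : i + bsize (Node l r) <= M ->
  tri_of r (i + bsize l).+1 =
  [set u in tri_of (Node l r) i | u \subset vertices (i + bsize l).+1 M.+1].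
Proof.
move=> hM; apply/setP => u; rewrite in_set /= !inE.
have hM' := hM; rewrite /= in hM'.
apply/idP/andP => [ur|[/or3P[/eqP->|ul|//] us]].
- rewrite ur !orbT; split=> //.
  have : u \subset vertices (i + bsize l).+1 ((i + bsize l).+1 + bsize r).+1.
    by apply: tri_of_arc ur; lia.
  by move/subset_trans; apply; apply: arc_sub; lia.
- move/subsetP: us => /(_ (inord i)).
  by rewrite !inE !inordK ?eqxx ?orbT; lia.
- have ul' : u \subset vertices i (i + bsize l).+1 by apply: tri_of_arc ul; lia.
  have := card_subI_arcs ul' us; rewrite setIid (card_tri_of _ ul) //; lia.
Qed.

Lemma top_in t i : t != Leaf -> top t i \in tri_of t i.
Proof. by case: t => // l r _; rewrite !inE eqxx. Qed.

(** The set of triangles shows which one rests on the base; its apex gives the size of the left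
    subtree, and filtering by arcs recovers both subtrees. *)
Lemma tri_of_inj t t' i : i + bsize t <= M -> bsize t = bsize t' ->
  tri_of t i = tri_of t' i -> t = t'.
Proof.
elim: t t' i => [|l IHl r IHr] [|l' r'] i // hM Es ET.
have hM' : i + bsize (Node l' r') <= M by rewrite -Es.
have := @top_in (Node l r) i isT; rewrite ET => /(tri_of_top hM').
have Hi : inord i \in top (Node l r) i by rewrite !inE eqxx.
have Hj : inord (i + bsize (Node l' r')).+1 \in top (Node l r) i.
  by rewrite -Es !inE eqxx orbT.
move=> /(_ Hi Hj) Etop.
have El : bsize l = bsize l'.
  have : inord (i + bsize l').+1 \in top (Node l r) i by rewrite Etop !inE eqxx orbT.
  rewrite in_tri; [|move: hM hM' => /=; lia ..].
  by rewrite inordK; move: hM hM' Es => /=; lia.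
have ETl := tri_of_left hM; rewrite ET El -tri_of_left // in ETl.
have ETr := tri_of_right hM; rewrite ET El -tri_of_right // in ETr.
move: hM hM' Es => /= hM hM' Es.
by congr Node; [apply: IHl ETl | apply: IHr ETr]; lia.
Qed.

(** * Adjacency and checkerboard colourings *)

Lemma top_left l r i : i + bsize (Node l r) <= M -> l != Leaf ->
  #|top (Node l r) i :&: top l i| = 2.
Proof.
case: l => // l1 l2 /= hM _.
have -> : tri i (i + (bsize l1 + bsize l2).+1).+1
    (i + ((bsize l1 + bsize l2).+1 + bsize r).+1).+1
    :&: tri i (i + bsize l1).+1 (i + (bsize l1 + bsize l2).+1).+1
  = [set inord i; inord (i + (bsize l1 + bsize l2).+1).+1].
  by apply/setP => x; rewrite inE !in_tri ?inE -?val_eqE /= ?inordK; lia.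
by rewrite cards2 -val_eqE /= !inordK; lia.
Qed.

Lemma top_right l r i : i + bsize (Node l r) <= M -> r != Leaf ->
  #|top (Node l r) i :&: top r (i + bsize l).+1| = 2.
Proof.
case: r => // r1 r2 /= hM _.
set k := (i + bsize l).+1; set j := (i + (bsize l + (bsize r1 + bsize r2).+1).+1).+1.
have -> : tri i k j :&: tri k (k + bsize r1).+1 (k + (bsize r1 + bsize r2).+1).+1
  = [set inord k; inord j].
  by apply/setP => x; rewrite inE !in_tri ?inE -?val_eqE /= ?inordK /k /j; lia.
by rewrite cards2 -val_eqE /= !inordK /k /j; lia.
Qed.

(** Two vertices common to the top and to the left part are the ends of the left chord, on which a
    single triangle of that part rests. Adjacency is thus the parent-child relation. *)
Lemma left_adjacent l r i u : i + bsize (Node l r) <= M -> u \in tri_of l i ->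
  #|top (Node l r) i :&: u| = 2 -> u = top l i.
Proof.
move=> hM ul cu; have hM' := hM; rewrite /= in hM'.
have /subsetP us : u \subset vertices i (i + bsize l).+1 by apply: tri_of_arc ul; lia.
have E : top (Node l r) i :&: u = [set inord i; inord (i + bsize l).+1].
  apply/eqP; rewrite eqEcard cards2 cu ltnS leq_b1 andbT.
  apply/subsetP => x; rewrite in_setI => /andP[+ /us].
  by rewrite in_tri ?inE -?val_eqE /= ?inordK; lia.
by apply: tri_of_top => //; [lia | ..];
  apply: (subsetP (subsetIr (top (Node l r) i) u)); rewrite E !inE eqxx ?orbT.
Qed.

Lemma right_adjacent l r i u : i + bsize (Node l r) <= M ->
  u \in tri_of r (i + bsize l).+1 ->
  #|top (Node l r) i :&: u| = 2 -> u = top r (i + bsize l).+1.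
Proof.
move=> hM ur cu; have hM' := hM; rewrite /= in hM'.
set k := (i + bsize l).+1; set j := (k + bsize r).+1.
have /subsetP us : u \subset vertices k j by apply: tri_of_arc ur; lia.
have E : top (Node l r) i :&: u = [set inord k; inord j].
  apply/eqP; rewrite eqEcard cards2 cu ltnS leq_b1 andbT.
  apply/subsetP => x; rewrite in_setI => /andP[+ /us].
  by rewrite in_tri ?inE -?val_eqE /= ?inordK /j /k; lia.
by apply: tri_of_top => //; [lia | ..];
  apply: (subsetP (subsetIr (top (Node l r) i) u)); rewrite E !inE eqxx ?orbT.
Qed.

(** Adjacency of parent and child forces the colours to alternate with depth. The colour of the top
    is prescribed only off leaves, because [top Leaf] is the empty set and not a triangle. *)
Lemma card_colour_class t i black col b : i + bsize t <= M ->
  checkerboard (tri_of t i) black -> (t != Leaf -> black (top t i) = col) ->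
  #|[set u in tri_of t i | black u == b]| = nodes (col == b) t.
Proof.
elim: t i col => [|l IHl r IHr] i col hM chk htop.
  by rewrite /= (_ : [set _ in _ | _] = set0) ?cards0 //; apply/setP => u; rewrite !inE.
have hM' := hM; rewrite /= in hM'.
have chkl : checkerboard (tri_of l i) black.
  by move=> u v ul vl; apply: chk; rewrite !inE (ul, vl) orbT.
have chkr : checkerboard (tri_of r (i + bsize l).+1) black.
  by move=> u v ul vl; apply: chk; rewrite !inE (ul, vl) !orbT.
have topl : l != Leaf -> black (top l i) = ~~ col.
  move=> nl; have := chk _ _ (@top_in (Node l r) i isT) _ (top_left hM nl); rewrite htop //.
  by rewrite !inE (top_in _ nl) orbT => /(_ isT); clear; case: col; case: (black _).
have topr : r != Leaf -> black (top r (i + bsize l).+1) = ~~ col.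
  move=> nr; have := chk _ _ (@top_in (Node l r) i isT) _ (top_right hM nr); rewrite htop //.
  by rewrite !inE (top_in _ nr) !orbT => /(_ isT); clear; case: col; case: (black _).
have -> : [set u in tri_of (Node l r) i | black u == b] =
   (if col == b then [set top (Node l r) i] else set0) :|:
   ([set u in tri_of l i | black u == b] :|:
    [set u in tri_of r (i + bsize l).+1 | black u == b]).
  apply/setP => u; rewrite !inE !andb_orl; congr (_ || _).
  have [->|nu] := eqVneq u (top (Node l r) i).
    by rewrite htop //; case: ifP; rewrite ?in_set1 ?eqxx ?in_set0.
  by case: ifP; rewrite ?in_set1 ?in_set0 ?(negPf nu).
rewrite cardsU [X in _ - X](_ : _ = 0); last first.
  apply/eqP; rewrite cards_eq0; apply/eqP/setP => u.
  rewrite !in_setI in_setU !in_set; case: ifP; rewrite !(in_set1, in_set0) //.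
  case: (u =P top (Node l r) i) => // ->; rewrite (negPf (top_notin_left hM)).
  by rewrite (negPf (top_notin_right hM)).
rewrite cardsU [X in _ + (_ - X)](_ : _ = 0); last first.
  have /pred0P D := disjoint_left_right hM.
  apply/eqP; rewrite cards_eq0; apply/eqP/setP => u; have := D u.
  by rewrite !inE /=; case: (u \in tri_of l i) => //= ->; rewrite andbF.
rewrite !subn0 (IHl i (~~ col)) //; last by lia.
rewrite (IHr _ (~~ col)) //; last by lia.
have -> : (~~ col == b) = ~~ (col == b) by case: (col); case: (b).
by rewrite [nodes _ (Node _ _)]/=; case: ifP; rewrite ?cards1 ?cards0.
Qed.

(** The witness that a checkerboard colouring exists: [true] at the top, negated on passing to a
    subtree. *)
Fixpoint colour t i u : bool :=
  if t is Node l r then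
    (u == top t i) ||
    ~~ (if u \in tri_of l i then colour l i u else colour r (i + bsize l).+1 u)
  else true.

Lemma colour_top t i : colour t i (top t i).
Proof. by case: t => //= l r; rewrite eqxx. Qed.

Lemma colour_left l r i u : i + bsize (Node l r) <= M -> u \in tri_of l i ->
  colour (Node l r) i u = ~~ colour l i u.
Proof.
move=> hM ul /=; rewrite ul; case: eqP => //= Eu.
by case/negP: (top_notin_left hM); rewrite -[top _ _]Eu.
Qed.

Lemma colour_right l r i u : i + bsize (Node l r) <= M ->
  u \in tri_of r (i + bsize l).+1 ->
  colour (Node l r) i u = ~~ colour r (i + bsize l).+1 u.
Proof.
move=> hM ur /=; rewrite (disjointFl (disjoint_left_right hM)) //; case: eqP => //= Eu.
by case/negP: (top_notin_right hM); rewrite -[top _ _]Eu.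
Qed.

(** Adjacent triangles are the top and the top of a subtree, or lie in the same subtree, since
    triangles of different sides share at most one vertex. *)
Lemma checkerboard_colour t i : i + bsize t <= M ->
  checkerboard (tri_of t i) (colour t i).
Proof.
elim: t i => [|l IHl r IHr] i hM; first by move=> u v; rewrite inE.
have hM' := hM; rewrite /= in hM'.
have chkl := IHl i ltac:(lia); have chkr := IHr (i + bsize l).+1 ltac:(lia).
have chk_top v : v \in tri_of (Node l r) i -> v != top (Node l r) i ->
    #|top (Node l r) i :&: v| = 2 -> colour (Node l r) i v = false.
  rewrite in_setU1 in_setU => /or3P[/eqP->|vl|vr] nv c2; first by rewrite eqxx in nv.
    by rewrite colour_left // (left_adjacent hM vl c2) colour_top.
  by rewrite colour_right // (right_adjacent hM vr c2) colour_top.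
move=> u v uT vT c2.
have nuv : u != v.
  by apply/eqP => Euv; move: c2; rewrite Euv setIid (card_tri_of _ vT).
have [Eu|nu] := eqVneq u (top (Node l r) i).
  by rewrite Eu colour_top (chk_top v) // -?Eu // eq_sym.
have [Ev|nv] := eqVneq v (top (Node l r) i).
  by rewrite Ev colour_top (chk_top u) // -?Ev // setIC.
move: uT vT; rewrite !in_setU1 -/(top (Node l r) i) !in_setU (negPf nu) (negPf nv) !orFb.
case/orP => [ul|ur] /orP[vl|vr].
- by rewrite !colour_left // (inj_eq negb_inj); apply: chkl.
- by have := card_left_right hM ul vr; rewrite c2.
- by have := card_left_right hM vl ur; rewrite setIC c2.
- by rewrite !colour_right // (inj_eq negb_inj); apply: chkr.
Qed.

Lemma fair_tri_of t i : i + bsize t <= M ->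
  fair (tri_of t i) <-> nodes true t = nodes false t.
Proof.
move=> hM; have count black col : checkerboard (tri_of t i) black ->
    (t != Leaf -> black (top t i) = col) ->
    #|[set u in tri_of t i | black u]| = nodes col t /\
    #|[set u in tri_of t i | ~~ black u]| = nodes (~~ col) t.
  move=> chk htop; split.
    rewrite -[X in nodes X](_ : (col == true) = _); last by case: col {htop}.
    rewrite -(card_colour_class true hM chk htop); congr #|pred_of_set _|.
    by apply/setP => u; rewrite !inE eqb_id.
  rewrite -[X in nodes X](_ : (col == false) = _); last by case: col {htop}.
  rewrite -(card_colour_class false hM chk htop); congr #|pred_of_set _|.
  by apply/setP => u; rewrite !inE eqbF_neg.
split=> [fairT|Et black chk].
  have chk := checkerboard_colour hM.
  have [<- <-] := count _ true chk (fun _ => colour_top t i).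
  exact: fairT.
have [-> ->] := count _ (black (top t i)) chk (fun _ => erefl).
by case: (black _); rewrite Et.
Qed.

End Combinatorics.

(** * Plane geometry *)

Import numFieldNormedType.Exports.
Local Open Scope classical_set_scope.
Local Open Scope ring_scope.

Section Plane.
Variable R : realType.
Implicit Types A B C D X : 'rV[R]_2.

(** Twice the signed area of the triangle, positive when [A], [B], [C] turn counterclockwise. *)
Definition orient A B C : R :=
  (B 0 0 - A 0 0) * (C 0 1 - A 0 1) - (B 0 1 - A 0 1) * (C 0 0 - A 0 0).

Lemma rowP2 A B : A 0 0 = B 0 0 -> A 0 1 = B 0 1 -> A = B.
Proof.
move=> e0 e1; apply/rowP => -[[|[|//]] lt_i].
  by rewrite (_ : Ordinal lt_i = 0) //; apply: val_inj.
by rewrite (_ : Ordinal lt_i = 1) //; apply: val_inj.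
Qed.

Lemma orientC A B C : orient A B C = orient B C A.
Proof. by rewrite /orient; ring. Qed.

Lemma orientN A B C : orient B A C = - orient A B C.
Proof. by rewrite /orient; ring. Qed.

Lemma orientxyx A B : orient A B A = 0.
Proof. by rewrite /orient; ring. Qed.

Lemma orientxyy A B : orient A B B = 0.
Proof. by rewrite /orient; ring. Qed.

Lemma orientD A B X C e : orient A B (X + e *: C) =
  orient A B X + e * ((B 0 0 - A 0 0) * C 0 1 - (B 0 1 - A 0 1) * C 0 0).
Proof. by rewrite /orient !mxE; ring. Qed.

Lemma orient_sum A B C X :
  orient B C X + orient C A X + orient A B X = orient A B C.
Proof. by rewrite /orient; ring. Qed.

Lemma barycentric A B C X : orient A B C != 0 ->
  X = (orient B C X / orient A B C) *: A + (orient C A X / orient A B C) *: B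
      + (orient A B X / orient A B C) *: C.
Proof. by move=> nz; apply: rowP2; rewrite !mxE; move: nz; rewrite /orient => nz; field. Qed.

Variables (N : nat) (p : 'I_N -> 'rV[R]_2).
Implicit Types (u v : {set 'I_N}).

(** [orient A B] is affine, so it commutes with convex combinations. The sign of [c] selects the
    side of the line. *)
Lemma hull_orient_ge0 (c : R) A B X u : hull p u X ->
  (forall i, i \in u -> 0 <= c * orient A B (p i)) -> 0 <= c * orient A B X.
Proof.
move=> [w [w0 w1 ->]] H.
have -> : orient A B (\sum_(i in u) w i *: p i) =
    \sum_(i in u) w i * orient A B (p i).
  have E i : w i * orient A B (p i) =
      (B 0 0 - A 0 0) * (w i *: p i) 0 1 - (B 0 1 - A 0 1) * (w i *: p i) 0 0
      + orient A B 0 * w i by rewrite /orient !mxE; ring.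
  under [RHS]eq_bigr => i _ do rewrite E.
  rewrite big_split /= sumrB -!mulr_sumr w1 -!summxE /orient !mxE; ring.
by rewrite mulr_sumr sumr_ge0 // => i iu; rewrite mulrCA mulr_ge0 ?H.
Qed.

(** The weights are sums of indicators, so that [a], [b], [c] may coincide and segments count as
    degenerate triangles. *)
Lemma hull_mem3 u a b c (x y z : R) : a \in u -> b \in u -> c \in u ->
  0 <= x -> 0 <= y -> 0 <= z -> x + y + z = 1 ->
  hull p u (x *: p a + y *: p b + z *: p c).
Proof.
move=> au bu cu x0 y0 z0 e1.
have pick i (V : lmodType R) (F : 'I_N -> V) : i \in u ->
    \sum_(l in u) (l == i)%:R *: F l = F i.
  move=> iu; rewrite (bigD1 i) //= eqxx scale1r big1 ?addr0 // => l /andP[_ /negPf->].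
  by rewrite scale0r.
exists (fun l => x * (l == a)%:R + y * (l == b)%:R + z * (l == c)%:R); split.
- by move=> l; rewrite !addr_ge0 ?mulr_ge0 ?ler0n.
- rewrite !big_split -!mulr_sumr /=.
  have pick1 i : i \in u -> \sum_(l in u) (l == i)%:R = 1 :> R.
    move=> iu; rewrite -[RHS](@pick i R^o (fun=> 1)) //.
    by apply: eq_bigr => l _; rewrite /GRing.scale /= mulr1.
  by rewrite !pick1 // !mulr1.
- under eq_bigr => l _ do rewrite !scalerDl -!scalerA.
  by rewrite !big_split -!scaler_sumr !pick.
Qed.

(** [D] times an orientation has the sign of a barycentric coordinate, whichever way the triangle
    turns. *)
Lemma hull_orient3 u a b c X (D := orient (p a) (p b) (p c)) :
  a \in u -> b \in u -> c \in u -> D != 0 ->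
  0 <= D * orient (p b) (p c) X -> 0 <= D * orient (p c) (p a) X ->
  0 <= D * orient (p a) (p b) X -> hull p u X.
Proof.
move=> au bu cu nz hx hy hz; rewrite (barycentric X nz).
have pos (k : R) : 0 <= D * k -> 0 <= k / D.
  move=> h; rewrite (_ : k / D = (D * k) * D^-1 ^+ 2); last by field.
  by rewrite mulr_ge0 ?sqr_ge0.
apply: hull_mem3 => //; try exact: pos.
by rewrite -!mulrDl orient_sum divff.
Qed.

Lemma continuous_orient A B : continuous (orient A B).
Proof.
have cM (a b : R) (j : 'I_2) : continuous (fun Y : 'rV[R]_2 => a * (Y 0 j - b)).
  move=> X; apply: (@continuousM _ _ (fun=> a) (fun Y : 'rV[R]_2 => Y 0 j - b)).
    exact: cst_continuous.
  apply: (@continuousB _ _ _ (fun Y : 'rV[R]_2 => Y 0 j) (fun=> b)).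
    exact: coord_continuous.
  exact: cst_continuous.
by move=> X; exact: continuousB (cM _ (A 0 1) 1 X) (cM _ (A 0 0) 0 X).
Qed.

Lemma interior_orient3 u a b c X (D := orient (p a) (p b) (p c)) :
  a \in u -> b \in u -> c \in u ->
  0 < D * orient (p b) (p c) X -> 0 < D * orient (p c) (p a) X ->
  0 < D * orient (p a) (p b) X -> interior (hull p u) X.
Proof.
move=> au bu cu hx hy hz.
have nz : D != 0 by apply: contraTneq hx => ->; rewrite mul0r ltxx.
have pos A B : 0 < D * orient A B X -> \forall Y \near X, 0 < D * orient A B Y.
  move=> h; have cD : continuous (fun Y => D * orient A B Y).
    move=> Z; apply: (@continuousM _ _ (fun=> D)); first exact: cst_continuous.
    exact: continuous_orient.
  exact: cvgr_gt (cD X) _ h.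
rewrite /interior /=; near=> Y.
apply: (@hull_orient3 u a b c) => //; apply: ltW; near: Y; exact: pos.
Unshelve. all: by end_near.
Qed.

(** Around a common interior point [orient A B] would vanish identically, yet it varies at the rate
    [orient A B C] in the direction [C - A]. *)
Lemma interiors_disjoint u v A B C : orient A B C != 0 ->
  (forall i, i \in u -> 0 <= orient A B (p i)) ->
  (forall i, i \in v -> orient A B (p i) <= 0) ->
  (interior (hull p u) `&` interior (hull p v) = classical_sets.set0)%classic.
Proof.
move=> nz hu hv; apply/seteqP; split=> // X [Xu Xv].
have near0 : \forall Y \near X, orient A B Y = 0.
  near=> Y; apply/eqP; rewrite eq_le; apply/andP; split.
    have : hull p v Y by near: Y.
    move/(@hull_orient_ge0 (-1) A B) => /(_ _); rewrite mulN1r oppr_ge0; apply => i /hv.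
    by rewrite mulN1r oppr_ge0.
  have : hull p u Y by near: Y.
  by move/(@hull_orient_ge0 1 A B) => /(_ _); rewrite mul1r; apply => i /hu; rewrite mul1r.
have cv : (fun d : R => X + d *: (C - A)) @ 0^'+ --> X + 0 *: (C - A).
  apply: cvg_at_right_filter; apply: cvgD; first exact: cvg_cst.
  by apply: cvgZ; [exact: cvg_id | exact: cvg_cst].
rewrite scale0r addr0 in cv.
have [d [d0]] : exists d : R, 0 < d /\ orient A B (X + d *: (C - A)) = 0.
  apply: (@filter_ex _ (0^'+)); near=> d; split; first by near: d; exact: nbhs_right_gt.
  by near: d; exact: cv near0.
rewrite orientD (nbhs_singleton near0) add0r => /eqP; rewrite mulf_eq0 gt_eqF //= => /eqP E.
by case/eqP: nz; rewrite -E /orient !mxE.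
Unshelve. all: by end_near.
Qed.

(** Finitely many strict inequalities survive a small perturbation; allowing every [e] up to [e0]
    leaves room for further bounds on [e]. *)
Lemma small_scale (s : seq (R * R)) : all (fun c => 0 < c.1) s ->
  exists2 e0 : R, 0 < e0 &
    forall e, 0 < e -> e <= e0 -> all (fun c => 0 < c.1 + e * c.2) s.
Proof.
elim: s => [_|[x y] s IHs /= /andP[x0 /IHs[e0 e00 H]]]; first by exists 1.
(* The added 1 covers [y = 0]. *)
exists (Num.min e0 (x / (`|y| + 1))) => [|e e_gt0].
  by rewrite lt_min e00 divr_gt0 // ltr_pwDr.
rewrite le_min => /andP[le0 le1]; rewrite H // andbT.
rewrite ler_pdivlMr ?ltr_pwDr // mulrDr mulr1 in le1.
have : - (e * `|y|) <= e * y by rewrite -mulrN ler_pM2l // lerNl -normrN ler_norm.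
lra.
Qed.

(* The two triangles contain the crossing point [z] of [a c] and [b d] in the
   relative interiors of these edges, so moving [z] slightly along [b d] towards
   the side of [r] and along [a c] towards the side of [s] enters both
   interiors. *)
Lemma crossing_interiors u v a c r b d s :
  a \in u -> c \in u -> r \in u -> b \in v -> d \in v -> s \in v ->
  orient (p a) (p c) (p r) != 0 -> orient (p b) (p d) (p s) != 0 ->
  orient (p a) (p c) (p b) * orient (p a) (p c) (p d) < 0 ->
  orient (p b) (p d) (p a) * orient (p b) (p d) (p c) < 0 ->
  (interior (hull p u) `&` interior (hull p v) <> classical_sets.set0)%classic.
Proof.
move=> au cu ru bv dv sv nzr nzs lt_ac lt_bd.
set A := p a in nzr lt_ac lt_bd; set C := p c in nzr lt_ac lt_bd; set U := p r in nzr.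
set B := p b in nzs lt_ac lt_bd; set D := p d in nzs lt_ac lt_bd; set S := p s in nzs.
(* The cross product of the diagonals [C - A] and [D - B], nonzero because [B] and [D] are on
   opposite sides of the line [A C]. *)
set k := orient A C D - orient A C B.
have kE : k = orient B D A - orient B D C by rewrite /k /orient; ring.
have k2 : 0 < k ^+ 2.
  have : 0 < orient A C D ^+ 2 + orient A C B ^+ 2 - 2 * (orient A C B * orient A C D).
    have := sqr_ge0 (orient A C D); have := sqr_ge0 (orient A C B); lra.
  by congr (_ < _); rewrite /k; ring.
have k0 : k != 0 by apply: contraTneq k2 => ->; rewrite expr0n ltxx.
have pos x y : x * (x - y) > 0 -> k ^+ 2 = (x - y) ^+ 2 -> 0 < x / (x - y).
  move=> h e; have nz : x - y != 0 by apply: contraTneq h => ->; rewrite mulr0 ltxx.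
  by rewrite (_ : x / (x - y) = x * (x - y) / k ^+ 2) ?divr_gt0 // e; field.
(* The parameters at which [orient B D] vanishes on [A C], and [orient A C] on [B D]. *)
set l := orient B D A / (orient B D A - orient B D C).
set m := orient A C B / (orient A C B - orient A C D).
have l0 : 0 < l by apply: pos; [have := sqr_ge0 (orient B D A); lra | rewrite kE].
have l1 : 0 < 1 - l.
  have -> : 1 - l = orient B D C / (orient B D C - orient B D A).
    have n1 : orient B D A - orient B D C != 0 by rewrite -kE.
    have n2 : orient B D C - orient B D A != 0 by rewrite -opprB oppr_eq0.
    by rewrite /l; field; rewrite n1 n2.
  by apply: pos; [have := sqr_ge0 (orient B D C); lra | rewrite kE; ring].
have m0 : 0 < m by apply: pos; [have := sqr_ge0 (orient A C B); lra | rewrite /k; ring].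
have m1 : 0 < 1 - m.
  have -> : 1 - m = orient A C D / (orient A C D - orient A C B).
    have n2 : orient A C B - orient A C D != 0 by rewrite -opprB oppr_eq0.
    by rewrite /m; field; rewrite n2 k0.
  by apply: pos; [have := sqr_ge0 (orient A C D); lra | rewrite /k; ring].
pose z := A + l *: (C - A).
have zE : z = B + m *: (D - B).
  have n2 : orient A C B - orient A C D != 0 by rewrite -opprB oppr_eq0.
  have n1 : orient B D A - orient B D C != 0 by rewrite -kE.
  by apply: rowP2; rewrite /z /l /m !mxE; move: n1 n2; rewrite /orient => n1 n2;
    field; rewrite n1 n2.
(* Along [w], [orient A C] varies at the rate [orient A C U * k ^+ 2] and [orient B D] at the rate
   [orient B D S * k ^+ 2], hence towards [U] and [S] whatever the signs. *)
pose w := (orient A C U * k) *: (D - B) - (orient B D S * k) *: (C - A).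
pose lin (P Q : 'rV[R]_2) : R := (Q 0 0 - P 0 0) * w 0 1 - (Q 0 1 - P 0 1) * w 0 0.
have sq (x : R) : x != 0 -> 0 < x ^+ 2 by move=> x0; rewrite exprn_even_gt0.
have /small_scale[e0 e0_gt0 He] : all (fun x : R * R => 0 < x.1)
    [:: (orient A C U * orient C U z, orient A C U * lin C U);
        (orient A C U * orient U A z, orient A C U * lin U A);
        (orient B D S * orient D S z, orient B D S * lin D S);
        (orient B D S * orient S B z, orient B D S * lin S B)].
  have -> : orient C U z = (1 - l) * orient A C U by rewrite /z /orient !mxE; ring.
  have -> : orient U A z = l * orient A C U by rewrite /z /orient !mxE; ring.
  have -> : orient D S z = (1 - m) * orient B D S by rewrite zE /orient !mxE; ring.
  have -> : orient S B z = m * orient B D S by rewrite zE /orient !mxE; ring.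
  by apply/and5P; split=> //=; rewrite mulrCA -expr2 mulr_gt0 // sq.
have /and5P[/= h1 h2 h3 h4 _] := He e0 e0_gt0 (lexx _).
suff : ((interior (hull p u) `&` interior (hull p v)) (z + e0 *: w))%classic.
  by move=> + E; rewrite E.
split.
  apply: (interior_orient3 au cu ru); rewrite -/A -/C -/U orientD mulrDr.
  - by rewrite mulrCA in h1 *.
  - by rewrite mulrCA in h2 *.
  - have -> : orient A C z = 0 by rewrite /z orientD orientxyx /orient !mxE; ring.
    rewrite mulr0 add0r (_ : _ * _ = e0 * (orient A C U ^+ 2 * k ^+ 2)).
      by rewrite mulr_gt0 // mulr_gt0 // sq.
    by rewrite /w /k /orient !mxE; ring.
apply: (interior_orient3 bv dv sv); rewrite -/B -/D -/S orientD mulrDr.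
- by rewrite mulrCA in h3 *.
- by rewrite mulrCA in h4 *.
- have -> : orient B D z = 0 by rewrite zE orientD orientxyx /orient !mxE; ring.
  rewrite mulr0 add0r (_ : _ * _ = e0 * (orient B D S ^+ 2 * k ^+ 2)).
    by rewrite mulr_gt0 // mulr_gt0 // sq.
  by rewrite /w /k /orient !mxE; ring.
Qed.

End Plane.

(** * Triangulations of a convex polygon *)

Lemma card3_tri M (u : {set 'I_M.+2}) : #|u| = 3%N ->
  exists a b c, [/\ (a < b)%N, (b < c)%N, (c <= M.+1)%N & u = tri M a b c].
Proof.
move=> u3; have: sorted ltn (map val (enum u)).
  have -> : map val (enum u) = [seq x <- iota 0 M.+2 | inord x \in u].
    rewrite -val_enum_ord filter_map [enum 'I_M.+2]enumT /enum_mem; congr map.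
    by apply: eq_filter => x; rewrite /= inord_val.
  by apply: sorted_filter; [exact: ltn_trans | exact: iota_ltn_sorted].
have: size (enum u) = 3%N by rewrite -cardE.
case E : (enum u) => [|x [|y [|z [|//]]]] // _ /= /and3P[xy yz _].
exists x, y, z; split=> //; first by rewrite -ltnS ltn_ord.
by apply/setP => l; rewrite -mem_enum E /tri !inord_val !inE orbA.
Qed.

Section ConvexPolygon.
Variables (R : realType) (M : nat) (q : 'I_M.+2 -> 'rV[R]_2).
Hypothesis ccw : forall x y z : 'I_M.+2,
  (x < y)%N -> (y < z)%N -> 0 < orient (q x) (q y) (q z).
Implicit Types (u v : {set 'I_M.+2}) (x y z : 'I_M.+2) (a b c i j k : nat).

Local Notation P i := (q (inord i)).

Lemma ccw_cyclic x y z : [|| x < y < z, y < z < x | z < x < y]%N ->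
  0 < orient (q x) (q y) (q z).
Proof.
case/or3P => /andP[h1 h2]; first exact: ccw.
  by rewrite orientC; exact: ccw.
by rewrite -orientC; exact: ccw.
Qed.

Lemma cw_cyclic x y z : [|| x < z < y, z < y < x | y < x < z]%N ->
  orient (q x) (q y) (q z) < 0.
Proof. by move=> h; rewrite orientN oppr_lt0; apply: ccw_cyclic; lia. Qed.

Lemma orient_neq0 x y z : x != y -> y != z -> z != x ->
  orient (q x) (q y) (q z) != 0.
Proof.
rewrite -!val_eqE /= => xy yz zx.
have [h|h] : [|| x < y < z, y < z < x | z < x < y]%N \/
    [|| x < z < y, z < y < x | y < x < z]%N by lia.
  by rewrite gt_eqF // ccw_cyclic.
by rewrite lt_eqF // cw_cyclic.
Qed.

Lemma chord_arc a c x : (a < c)%N -> (c <= M.+1)%N -> (a <= x <= c)%N ->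
  orient (P a) (P c) (q x) <= 0.
Proof.
move=> ac cM axc; have [/eqP xa|xa] := boolP (x == a :> nat).
  by rewrite -xa inord_val orientxyx.
have [/eqP xc|xc] := boolP (x == c :> nat).
  by rewrite -xc inord_val orientxyy.
by apply/ltW/cw_cyclic; rewrite !inordK; lia.
Qed.

Lemma chord_coarc a c x : (a < c)%N -> (c <= M.+1)%N -> ~~ (a < x < c)%N ->
  0 <= orient (P a) (P c) (q x).
Proof.
move=> ac cM axc; have [/eqP xa|xa] := boolP (x == a :> nat).
  by rewrite -xa inord_val orientxyx.
have [/eqP xc|xc] := boolP (x == c :> nat).
  by rewrite -xc inord_val orientxyy.
by apply/ltW/ccw_cyclic; rewrite !inordK; lia.
Qed.

(** The ends of [i k] and [a c] alternate along the boundary, so each chord separates the ends of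
    the other; [r] and [s] are third vertices. *)
Lemma chords_cross u v i a k c r s : (i < a)%N -> (a < k)%N -> (k < c)%N ->
  (c <= M.+1)%N -> (r <= M.+1)%N -> (s <= M.+1)%N ->
  [&& r != i, r != k, s != a & s != c] ->
  [&& inord i \in u, inord k \in u & inord r \in u] ->
  [&& inord a \in v, inord c \in v & inord s \in v] ->
  (interior (hull q u) `&` interior (hull q v) <> classical_sets.set0)%classic.
Proof.
move=> ia ak kc cM rM sM /and4P[ri rk sa sc] /and3P[iu ku ru] /and3P[av cv sv].
apply: (crossing_interiors iu ku ru av cv sv).
- by apply: orient_neq0; rewrite -val_eqE /= !inordK; lia.
- by apply: orient_neq0; rewrite -val_eqE /= !inordK; lia.
- by rewrite nmulr_rlt0; [apply: ccw_cyclic | apply: cw_cyclic]; rewrite !inordK; lia.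
- by rewrite pmulr_rlt0; [apply: cw_cyclic | apply: ccw_cyclic]; rewrite !inordK; lia.
Qed.

Lemma tri_arc i j a b c : (a < b)%N -> (b < c)%N -> (c <= M.+1)%N ->
  (tri M a b c \subset vertices M i j) = (i <= a)%N && (c <= j)%N.
Proof.
move=> ab bc cM; apply/subsetP/idP => [h|h x]; last by rewrite in_tri ?inE; lia.
have := h (inord a); have := h (inord c); rewrite !inE !eqxx !orbT !inordK; lia.
Qed.

(** If [v] has vertices strictly on both sides of [k], one of its edges crosses [i k] or [k j]: the
    edge joining its extreme vertices if this is not [i j], otherwise an edge at its middle
    vertex. *)
Lemma noncrossing_split v i k j : (i < k)%N -> (k < j)%N -> (j <= M.+1)%N ->
  #|v| = 3%N -> v \subset vertices M i j -> v != tri M i k j ->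
  (interior (hull q (tri M i k j)) `&` interior (hull q v) =
     classical_sets.set0)%classic ->
  v \subset vertices M i k \/ v \subset vertices M k j.
Proof.
move=> ik kj jM /card3_tri[a [b [c [ab bc cM ->]]]].
rewrite !tri_arc // => /andP[ia cj] ne disj.
have [ck|kc] := leqP c k; first by left; rewrite ia.
have [ka|ak] := leqP k a; first by right; rewrite cj.
case: notF; move: disj.
have [ia'|ai] := ltnP i a.
  by case/(@chords_cross _ _ i a k c j b); rewrite ?inE ?eqxx ?orbT; lia.
have [cj'|jc] := ltnP c j.
  rewrite classical_sets.setIC.
  by case/(@chords_cross _ _ a k c j b i); rewrite ?inE ?eqxx ?orbT; lia.
have {ai ia} ai : a = i by lia.
have {cj jc} cj : c = j by lia.
subst a c; have [bk|kb|bk] := ltngtP b k; last by rewrite bk eqxx in ne.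
  by case/(@chords_cross _ _ i b k j j i); rewrite ?inE ?eqxx ?orbT; lia.
rewrite classical_sets.setIC.
by case/(@chords_cross _ _ i k b j j i); rewrite ?inE ?eqxx ?orbT; lia.
Qed.

(* A point just inside the polygon, near the midpoint of the edge [i j]: any
   triangle of the arc covering it must have [i] and [j] as vertices. *)
Lemma edge_triangle (T : {set {set 'I_M.+2}}) i j : (i.+1 < j)%N -> (j <= M.+1)%N ->
  (forall u, u \in T -> #|u| = 3%N) ->
  (\bigcup_(u in [set` T]) hull q u)%classic = hull q [set: 'I_M.+2] ->
  (forall u, u \in T ->
     u \subset vertices M i j \/ (forall x, x \in u -> ~~ (i < x < j)%N)) ->
  exists k, [/\ (i < k)%N, (k < j)%N & tri M i k j \in T].
Proof.
move=> ij jM T3 cover split.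
pose m := 2^-1 *: P i + 2^-1 *: P j.
(* The chords of the arc other than [i j]: the midpoint [m] is strictly on the left of each, whereas
   a triangle with extreme vertices [a] and [c] is on the right of [a c]. *)
pose chord (ac : 'I_M.+2 * 'I_M.+2) :=
  [&& i <= ac.1, ac.1 < ac.2, ac.2 <= j & (ac.1 != i :> nat) || (ac.2 != j :> nat)]%N.
pose f (ac : 'I_M.+2 * 'I_M.+2) X := orient (q ac.1) (q ac.2) X.
have /small_scale[e0 e0_gt0 He0] : all (fun x : R * R => 0 < x.1)
    [seq (f ac m, f ac (P i.+1) - f ac m) | ac <- enum chord].
  apply/allP => _ /mapP[[a c] + ->]; rewrite mem_enum /in_mem /= => /and4P[/= ia ac cj ne].
  have -> : f (a, c) m = 2^-1 * (f (a, c) (P i) + f (a, c) (P j)).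
    by rewrite /f /m /orient !mxE; field.
  rewrite mulr_gt0 ?invr_gt0 //.
  have hi : 0 <= f (a, c) (P i).
    by rewrite /f -[a]inord_val -[c]inord_val; apply: chord_coarc; rewrite ?inordK //; lia.
  have hj : 0 <= f (a, c) (P j).
    by rewrite /f -[a]inord_val -[c]inord_val; apply: chord_coarc; rewrite ?inordK //; lia.
  rewrite /= in ia ac cj ne; case/orP: ne => ne.
    by apply: ltr_pwDl hj; apply: ccw_cyclic; rewrite /= inordK; lia.
  by apply: ltr_wpDl hi _; apply: ccw_cyclic; rewrite /= inordK; lia.
(* The second bound keeps the weights of [X] nonnegative. *)
pose e := Num.min e0 2^-1.
have e_gt0 : 0 < e by rewrite lt_min e0_gt0 invr_gt0 ltr0n.
have e_half : e <= 2^-1 by rewrite ge_min lexx orbT.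
have /allP He : all (fun x : R * R => 0 < x.1 + e * x.2)
    [seq (f ac m, f ac (P i.+1) - f ac m) | ac <- enum chord].
  by apply: He0 => //; rewrite ge_min lexx.
(* [X] is [m] moved by the fraction [e] towards the vertex after [i]. *)
pose X := (2^-1 * (1 - e)) *: P i + (2^-1 * (1 - e)) *: P j + e *: P i.+1.
have fX A C : orient A C X = orient A C m + e * (orient A C (P i.+1) - orient A C m).
  by rewrite /X /m /orient !mxE; field.
have : hull q [set: 'I_M.+2] X.
  by apply: hull_mem3; rewrite ?inE //; [lra | lra | lra | field].
rewrite -cover => -[u /= uT uX].
(* A triangle beyond [i j] is excluded because [X] is strictly on the side of the arc. *)
have [uarc|uco] := split _ uT; last first.
  have : 0 <= orient (P i) (P j) X.
    rewrite -[orient _ _ _]mul1r; apply: (hull_orient_ge0 uX) => x /uco xij.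
    by rewrite mul1r; apply: chord_coarc => //; lia.
  rewrite leNgt => /negP[].
  have -> : orient (P i) (P j) X = e * orient (P i) (P j) (P i.+1).
    by rewrite /X /orient !mxE; field.
  by rewrite pmulr_rlt0 //; apply: cw_cyclic; rewrite !inordK; lia.
have [a [b [c [ab bc cM Eu]]]] := card3_tri (T3 _ uT).
move: uarc; rewrite Eu tri_arc // => /andP[ia cj].
have uac : orient (P a) (P c) X <= 0.
  rewrite -oppr_ge0 -mulN1r; apply: (hull_orient_ge0 uX) => x.
  rewrite Eu in_tri => [xu|||]; try lia.
  by rewrite mulN1r oppr_ge0; apply: chord_arc; lia.
have [/andP[/eqP Ea /eqP Ec]|ne] := boolP ((a == i) && (c == j)).
  by exists b; rewrite -Ea -Ec -Eu.
suff /He /= : (f (inord a, inord c) m,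
    f (inord a, inord c) (P i.+1) - f (inord a, inord c) m) \in
    [seq (f ac m, f ac (P i.+1) - f ac m) | ac <- enum chord].
  by rewrite /f /= -fX ltNge uac.
apply/mapP; exists (inord a, inord c) => //.
by rewrite mem_enum /in_mem /= /chord /= !inordK; lia.
Qed.

(** The covering hypothesis stays that of the whole polygon, so no part has to be shown covered.
    What descends is that each triangle lies on one side of the chord; for [i k] and [k j] this
    comes from not crossing the triangle [i k j]. *)
Lemma triangulation_arc (T : {set {set 'I_M.+2}}) i j :
  (i < j)%N -> (j <= M.+1)%N ->
  (forall u, u \in T -> #|u| = 3%N) ->
  (forall u v, u \in T -> v \in T -> u != v ->
     (interior (hull q u) `&` interior (hull q v) = classical_sets.set0)%classic) ->
  (\bigcup_(u in [set` T]) hull q u)%classic = hull q [set: 'I_M.+2] ->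
  (forall u, u \in T ->
     u \subset vertices M i j \/ (forall x, x \in u -> ~~ (i < x < j)%N)) ->
  exists2 t, j = (i + bsize t).+1 & [set u in T | u \subset vertices M i j] = tri_of M t i.
Proof.
move=> ij jM T3 disj cover; have [d] := ubnP (j - i)%N.
elim: d => // d IHd in i j ij jM *; move=> le_d split.
have [ij1|ij1] := ltnP i.+1 j; last first.
  exists Leaf; first by rewrite /=; lia.
  apply/setP => u; rewrite !inE; apply/negP => /andP[/T3/card3_tri[a [b [c [ab bc cM ->]]]]].
  by rewrite tri_arc //; lia.
have [k [ik kj kT]] := edge_triangle ij1 jM T3 cover split.
have split_k u : u \in T -> u \subset vertices M i j ->
    [\/ u = tri M i k j, u \subset vertices M i k | u \subset vertices M k j].
  move=> uT uij; have [->|nu] := eqVneq u (tri M i k j); first by constructor 1.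
  have [|h|h] := noncrossing_split ik kj jM (T3 _ uT) uij nu; [|by constructor 2|by constructor 3].
  by apply: disj; rewrite // eq_sym.
have [||||l El Tl] := IHd i k; try lia.
  move=> u uT; have [/(split_k _ uT)[->|h|h]|h] := split _ uT.
  - by right=> x; rewrite in_tri; lia.
  - by left.
  - by right=> x /(subsetP h); rewrite inE; lia.
  - by right=> x /h; lia.
have [||||r Er Tr] := IHd k j; try lia.
  move=> u uT; have [/(split_k _ uT)[->|h|h]|h] := split _ uT.
  - by right=> x; rewrite in_tri; lia.
  - by right=> x /(subsetP h); rewrite inE; lia.
  - by left.
  - by right=> x /h; lia.
exists (Node l r); first by rewrite /=; lia.
rewrite /= -El (_ : (i + (bsize l + bsize r).+1).+1 = j); last by lia.
rewrite -Tl -Tr; apply/setP => u; rewrite !inE.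
apply/andP/or3P => [[uT /(split_k _ uT)[->|h|h]]|[/eqP->|/andP[uT h]|/andP[uT h]]].
- by constructor 1.
- by constructor 2; rewrite uT.
- by constructor 3; rewrite uT.
- by rewrite kT tri_arc ?leqnn //; lia.
- by rewrite uT; split=> //; apply: subset_trans h (arc_sub _ _ _); lia.
- by rewrite uT; split=> //; apply: subset_trans h (arc_sub _ _ _); lia.
Qed.

Lemma chord_separates u v a c : (a < c)%N -> (c <= M.+1)%N -> #|u| = 3%N ->
  u \subset vertices M a c -> (forall x, x \in v -> ~~ (a < x < c)%N) ->
  (interior (hull q u) `&` interior (hull q v) = classical_sets.set0)%classic.
Proof.
move=> ac cM /card3_tri[i [k [j [ik kj jM Eu]]]] uac vac; rewrite classical_sets.setIC.
have := uac; rewrite Eu tri_arc // => /andP[ai jc]; rewrite -Eu.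
(* The middle vertex of [u] is strictly inside the arc, hence off the chord. *)
apply: (@interiors_disjoint _ _ _ _ _ (P a) (P c) (P k)).
- by apply: orient_neq0; rewrite -val_eqE /= !inordK; lia.
- by move=> x /vac; apply: chord_coarc.
- by move=> x /(subsetP uac); rewrite inE; apply: chord_arc.
Qed.

Lemma tri_of_disjoint t i u v : (i + bsize t <= M)%N ->
  u \in tri_of M t i -> v \in tri_of M t i -> u != v ->
  (interior (hull q u) `&` interior (hull q v) = classical_sets.set0)%classic.
Proof.
elim: t i u v => [|l IHl r IHr] i u v hM; first by rewrite inE.
have hM' := hM; rewrite /= in hM'.
pose k := (i + bsize l).+1; pose j := (i + (bsize l + bsize r).+1).+1.
have left w : w \in tri_of M l i -> #|w| = 3%N /\ w \subset vertices M i k.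
  by move=> wl; split; [apply: card_tri_of wl | apply: tri_of_arc wl]; lia.
have right w : w \in tri_of M r k -> #|w| = 3%N /\ w \subset vertices M k j.
  move=> wr; split; first by apply: card_tri_of wr; rewrite /k; lia.
  by rewrite (_ : j = (k + bsize r).+1); [apply: tri_of_arc wr|]; rewrite /k /j; lia.
have top_left w : w \in tri_of M l i ->
    (interior (hull q w) `&` interior (hull q (top M (Node l r) i)) =
       classical_sets.set0)%classic.
  move=> /left[w3 wk]; apply: (chord_separates _ _ w3 wk); try (rewrite /k; lia).
  by move=> x; rewrite in_tri /k /=; lia.
have top_right w : w \in tri_of M r k ->
    (interior (hull q w) `&` interior (hull q (top M (Node l r) i)) =
       classical_sets.set0)%classic.
  move=> /right[w3 wk]; apply: (chord_separates _ _ w3 wk); try (rewrite /k /j; lia).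
  by move=> x; rewrite in_tri /k /j /=; lia.
have left_right w1 w2 : w1 \in tri_of M l i -> w2 \in tri_of M r k ->
    (interior (hull q w1) `&` interior (hull q w2) = classical_sets.set0)%classic.
  move=> /left[w3 wk] /right[_ wj]; apply: (chord_separates _ _ w3 wk); try (rewrite /k; lia).
  by move=> x /(subsetP wj); rewrite inE; lia.
rewrite !in_setU1 -/(top M (Node l r) i) !in_setU.
case/or3P => [/eqP->|ul|ur] /or3P[/eqP->|vl|vr]; rewrite ?eqxx // => uv.
- by rewrite classical_sets.setIC top_left.
- by rewrite classical_sets.setIC top_right.
- exact: top_left.
- by apply: IHl vl uv => //; lia.
- exact: left_right.
- exact: top_right.
- by rewrite classical_sets.setIC left_right.
- by apply: IHr vr uv => //; lia.
Qed.

(** A point beyond [i k] or [k j] belongs to the subpolygon there, which is no bare edge since the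
    point respects all edges; any other point is in the top triangle. Describing the polygon by
    half-planes lets the hypotheses pass to subpolygons. *)
Lemma tri_of_cover t i X : (i + bsize t <= M)%N -> t != Leaf ->
  (forall l, (i <= l <= i + bsize t)%N -> 0 <= orient (P l) (P l.+1) X) ->
  orient (P i) (P (i + bsize t).+1) X <= 0 ->
  exists2 u, u \in tri_of M t i & hull q u X.
Proof.
elim: t i => // l IHl r IHr i hM _ edges base.
have hM' := hM; rewrite /= in hM'.
pose k := (i + bsize l).+1; pose j := (i + (bsize l + bsize r).+1).+1.
have [ik|ik] := lerP 0 (orient (P i) (P k) X); last first.
  have [||||u ul uX] := IHl i; try lia.
  - by apply: contraTneq ik => El; rewrite /k El /= addn0 -leNgt edges //; lia.
  - by move=> m hm; apply: edges; rewrite /=; lia.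
  - exact: ltW.
  by exists u => //; rewrite !inE ul orbT.
have [kj|kj] := lerP 0 (orient (P k) (P j) X); last first.
  have jE : j = (k + bsize r).+1 by rewrite /j /k; lia.
  have [||||u ur uX] := IHr k; try (rewrite /k; lia).
  - apply: contraTneq kj => Er; rewrite jE Er /= addn0 -leNgt edges //=; rewrite /k; lia.
  - by move=> m; rewrite /k => hm; apply: edges; rewrite /=; lia.
  - by rewrite -jE; exact: ltW.
  by exists u => //; rewrite !inE ur !orbT.
exists (top M (Node l r) i); first by rewrite !inE eqxx.
have D0 : 0 < orient (P i) (P k) (P j).
  by apply: ccw_cyclic; rewrite !inordK /k /j; lia.
apply: (@hull_orient3 _ _ _ _ (inord i) (inord k) (inord j)).
1-3: by rewrite !inE eqxx ?orbT.
- by rewrite gt_eqF.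
- by rewrite pmulr_rge0.
- by rewrite pmulr_rge0 // orientN oppr_ge0.
- by rewrite pmulr_rge0.
Qed.

Lemma triangulationP (T : {set {set 'I_M.+2}}) :
  triangulation q T <-> exists2 t, bsize t = M & T = tri_of M t 0.
Proof.
have full u : u \subset vertices M 0 M.+1.
  by apply/subsetP => x _; rewrite inE; have := ltn_ord x; lia.
split=> [[T3 disj cover]|[t tM ->]].
  have [M0|M_gt0] := posnP M.
    exists Leaf => //; apply/setP => u; rewrite inE; apply/negP => /T3/card3_tri.
    by case=> a [b [c [ab bc cM _]]]; lia.
  have splitT u : u \in T ->
      u \subset vertices M 0 M.+1 \/ (forall x, x \in u -> ~~ (0 < x < M.+1)%N).
    by left; exact: full.
  have M2 : (2 < M.+2)%N by lia.
  have [t tM Tt] := triangulation_arc (ltn0Sn M) (leqnn M.+1) T3 disj (cover M2) splitT.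
  exists t; first by move: tM; rewrite add0n => -[].
  by rewrite -Tt; apply/setP => u; rewrite inE full andbT.
split=> [u uT|u v|M2].
- by apply: card_tri_of uT; lia.
- by apply: tri_of_disjoint; lia.
apply/seteqP; split=> [X [u _ [w [w0 w1 ->]]]|X fX].
  (* Weights on [u] extended by zero. *)
  exists (fun x => w x * (x \in u)%:R); split.
  - by move=> x; rewrite mulr_ge0 ?ler0n.
  - rewrite -[RHS]w1 [RHS]big_mkcond /=; apply: eq_big => [x|x _]; first by rewrite inE.
    by case: ifP; rewrite ?mulr1 ?mulr0.
  - rewrite [LHS]big_mkcond /=; apply: eq_big => [x|x _]; first by rewrite inE.
    by case: ifP; rewrite ?mulr1 ?mulr0 ?scale0r.
have [||||u uT uX] := @tri_of_cover t 0 X; last by exists u.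
- by lia.
- by case: t tM => //= tM; lia.
- move=> l hl; rewrite -[orient _ _ _]mul1r; apply: (hull_orient_ge0 fX) => x _.
  by rewrite mul1r; apply: chord_coarc; lia.
- rewrite -oppr_ge0 -mulN1r; apply: (hull_orient_ge0 fX) => x _.
  rewrite mulN1r oppr_ge0; apply: chord_arc; rewrite ?tM //; have := ltn_ord x; lia.
Qed.

Lemma card_fair_triangulations n : M = (2 * n)%N ->
  #|fair_triangulations q| = size (btrees n n).
Proof.
move=> Mn.
have inj : {in btrees n n &, injective (fun t => tri_of M t 0)}.
  move=> t t'; rewrite !mem_btrees_rec // => /andP[/eqP ht /eqP hf] /andP[/eqP ht' /eqP hf'].
  by move/tri_of_inj; apply; rewrite !(bsizeE true) /=; lia.
rewrite -(size_map (fun t => tri_of M t 0)) -(card_uniqP _); last first.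
  by rewrite map_inj_in_uniq // uniq_btrees_rec.
apply: eq_card => T; rewrite inE.
apply/asboolP/mapP => [[/triangulationP[t tM ->]]|[t]].
  move/fair_tri_of => /(_ ltac:(lia)) ht; exists t => //.
  by rewrite mem_btrees_rec //; move: tM; rewrite (bsizeE true) /=; lia.
rewrite mem_btrees_rec // => /andP[/eqP ht /eqP hf] ->.
have tM : bsize t = M by rewrite (bsizeE true) /=; lia.
split; first by apply/triangulationP; exists t.
by apply/fair_tri_of; [lia | rewrite ht hf].
Qed.

End ConvexPolygon.

(** * Cyclic order of the vertices *)

Section Order.
Variables (R : realType) (N : nat) (p : 'I_N -> 'rV[R]_2).
Hypothesis p_convex : strictly_convex p.
Implicit Types a b c i x y z : 'I_N.

Lemma not_convex_comb i a b c (s t r : R) : a != i -> b != i -> c != i ->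
  0 <= s -> 0 <= t -> 0 <= r -> s + t + r = 1 ->
  p i <> s *: p a + t *: p b + r *: p c.
Proof.
move=> ai bi ci s0 t0 r0 e E; apply: (p_convex (i := i)); rewrite E.
by apply: hull_mem3; rewrite ?inE.
Qed.

Lemma not_in_triangle i a b c : a != i -> b != i -> c != i ->
  0 < orient (p a) (p b) (p c) -> 0 <= orient (p b) (p c) (p i) ->
  0 <= orient (p c) (p a) (p i) -> 0 <= orient (p a) (p b) (p i) -> False.
Proof.
move=> ai bi ci D0 h1 h2 h3; apply: (p_convex (i := i)).
apply: (@hull_orient3 _ _ _ _ a b c); rewrite ?pmulr_rge0 //; last by rewrite gt_eqF.
all: by rewrite !inE.
Qed.

(** Of three collinear points one lies between the others; which one depends on the place of [l]
    relative to 0 and 1. *)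
Lemma not_collinear a b c : a != b -> b != c -> c != a ->
  orient (p a) (p b) (p c) != 0.
Proof.
move=> ab bc ca; apply/eqP => abc0.
set v0 := p b 0 0 - p a 0 0; set v1 := p b 0 1 - p a 0 1.
have n_gt0 : 0 < v0 ^+ 2 + v1 ^+ 2.
  rewrite lt_neqAle addr_ge0 ?sqr_ge0 // andbT eq_sym paddr_eq0 ?sqr_ge0 // !sqrf_eq0.
  apply/negP => /andP[/eqP e0 /eqP e1].
  apply: (@not_convex_comb b a a a 1 0 0); rewrite ?ler01 // ?addr0 //.
  by apply: rowP2; rewrite !mxE; move: e0 e1; rewrite /v0 /v1; lra.
(* The parameter of the orthogonal projection of [p c] on the line through [p a] and [p b]; the
   error is a multiple of the orientation, which vanishes. *)
pose l := ((p c 0 0 - p a 0 0) * v0 + (p c 0 1 - p a 0 1) * v1) / (v0 ^+ 2 + v1 ^+ 2).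
have Ec : p c = (1 - l) *: p a + l *: p b + 0 *: p a.
  have nz : v0 ^+ 2 + v1 ^+ 2 != 0 by rewrite gt_eqF.
  have e (x y : R) : (x - y) * (v0 ^+ 2 + v1 ^+ 2) = 0 -> x = y.
    by move/eqP; rewrite mulf_eq0 (negPf nz) orbF subr_eq0 => /eqP.
  have eb0 : p b 0 0 = v0 + p a 0 0 by rewrite /v0 subrK.
  have eb1 : p b 0 1 = v1 + p a 0 1 by rewrite /v1 subrK.
  apply: rowP2; apply: e; rewrite !mxE /l.
    transitivity (- v1 * orient (p a) (p b) (p c)); last by rewrite abc0 mulr0.
    by rewrite /orient -/v0 -/v1 eb0; field.
  transitivity (v0 * orient (p a) (p b) (p c)); last by rewrite abc0 mulr0.
  by rewrite /orient -/v0 -/v1 eb1; field.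
have ba : b != a by rewrite eq_sym.
have cb : c != b by rewrite eq_sym.
have ac : a != c by rewrite eq_sym.
have [l_lt0|l_ge0] := ltP l 0.
  have h : 0 < 1 - l by lra.
  apply: (@not_convex_comb a c b b (1 - l)^-1 (- l / (1 - l)) 0) => //.
  - by rewrite invr_ge0 ltW.
  - by rewrite divr_ge0 ?ltW // oppr_gt0.
  - by field; rewrite gt_eqF.
  - by apply: rowP2; rewrite Ec !mxE; field; rewrite gt_eqF.
have [l_le1|l_gt1] := leP l 1.
  by apply: (@not_convex_comb c a b a (1 - l) l 0) Ec; rewrite ?subr_ge0 //; ring.
have h : 0 < l by lra.
apply: (@not_convex_comb b a c c (1 - l^-1) l^-1 0) => //.
- by rewrite subr_ge0 invf_le1 // ltW.
- by rewrite invr_ge0 ltW.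
- by ring.
- by apply: rowP2; rewrite Ec !mxE; field; rewrite gt_eqF.
Qed.

(* The other vertices all lie within a half-plane seen from the vertex [o], so
   they are totally ordered by their direction from [o]. *)
Lemma ccw_from_trans o x y z : o != x -> o != y -> o != z ->
  0 < orient (p o) (p x) (p y) -> 0 < orient (p o) (p y) (p z) ->
  0 < orient (p o) (p x) (p z).
Proof.
move=> ox oy oz xy yz.
have xz : x != z.
  apply: contraTneq yz => <-; rewrite -leNgt -oppr_ge0.
  rewrite (_ : - _ = orient (p o) (p x) (p y)) ?ltW //.
  by rewrite /orient; ring.
(* Otherwise the directions would go all the way round [o], placing it in the triangle [x y z]. *)
rewrite ltNge; apply/negP => zx.
have E : orient (p z) (p x) (p o) = - orient (p o) (p x) (p z) by rewrite /orient; ring.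
apply: (@not_in_triangle o x y z); rewrite 1?eq_sym //; last 3 first.
- by rewrite -orientC ltW.
- by rewrite E oppr_ge0.
- by rewrite -orientC ltW.
rewrite -(orient_sum _ _ _ (p o)) E -!(orientC (p o)); lra.
Qed.

(** Otherwise [y] would lie in the triangle [o x z]. *)
Lemma ccw_from_ccw o x y z : o != x -> o != y -> o != z -> x != y -> y != z -> z != x ->
  0 < orient (p o) (p x) (p y) -> 0 < orient (p o) (p y) (p z) ->
  0 < orient (p x) (p y) (p z).
Proof.
move=> ox oy oz xy_ yz_ zx xy yz.
rewrite lt_neqAle eq_sym not_collinear // leNgt; apply/negP => neg.
have xz := ccw_from_trans ox oy oz xy yz.
apply: (@not_in_triangle y o x z) => //; first by rewrite eq_sym.
- by rewrite (_ : orient _ _ _ = - orient (p x) (p y) (p z)) ?oppr_ge0 ?ltW // /orient; ring.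
- by rewrite orientC ltW.
- exact: ltW.
Qed.

Lemma ccw_order : exists s : {perm 'I_N}, forall x y z : 'I_N,
  (x < y)%N -> (y < z)%N -> 0 < orient (p (s x)) (p (s y)) (p (s z)).
Proof.
have [o _|no] := pickP (pred_of_simpl (@predT 'I_N)); last by exists 1%g => x; have := no x.
(* The order by direction from [o], with [o] itself as least element. *)
pose le : rel 'I_N := fun x y =>
  [|| x == y, x == o | (y != o) && (0 < orient (p o) (p x) (p y))].
have le_total : total le.
  move=> x y; rewrite /le; have [//|xy] := eqVneq x y.
  have [//|xo] := eqVneq x o; have [->|yo] := eqVneq y o; first by rewrite ?eqxx !orbT.
  rewrite /=; case: (ltgtP 0 (orient (p o) (p x) (p y))) => //= h.
    by rewrite (_ : orient _ _ _ = - orient (p o) (p x) (p y)) ?oppr_gt0 // /orient; ring.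
  by have := @not_collinear o x y; rewrite (eq_sym o) xo xy yo -h eqxx => /(_ isT isT isT).
have le_trans : transitive le.
  move=> y x z; rewrite /le.
  have [->//|xy /=] := eqVneq x y; have [_|xo /=] := eqVneq x o; first by rewrite orbT.
  case/andP => yo xy_gt0; have [<-|yz /=] := eqVneq y z; first by rewrite yo xy_gt0 orbT.
  rewrite (negPf yo) /= => /andP[zo yz_gt0]; rewrite zo.
  by rewrite (@ccw_from_trans o x y z) ?orbT // eq_sym.
pose s := sort le (enum 'I_N).
have size_s : size s = N by rewrite size_sort size_enum_ord.
have uniq_s : uniq s by rewrite sort_uniq enum_uniq.
have sorted_s : sorted le s := sort_sorted le_total _.
have inj : injective (fun x : 'I_N => nth o s x).
  by move=> x y /eqP; rewrite nth_uniq ?size_s // => /eqP/val_inj.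
exists (perm inj) => x y z xy yz; rewrite !permE.
have ne (x1 y1 : 'I_N) : (x1 < y1)%N -> nth o s x1 != nth o s y1.
  by move=> h; rewrite nth_uniq ?size_s // neq_ltn h.
have le_nth (x1 y1 : 'I_N) : (x1 < y1)%N -> le (nth o s x1) (nth o s y1).
  by move=> h; apply: (sorted_ltn_nth le_trans) => //; rewrite inE size_s.
have xz := ltn_trans xy yz.
move: (ne _ _ xy) (ne _ _ yz) (ne _ _ xz) (le_nth _ _ xy) (le_nth _ _ yz).
move: (nth o s x) (nth o s y) (nth o s z) => a b c ab bc ac.
rewrite /le (negPf ab) (negPf bc) /=.
have [ao|ao /= /andP[bo ab_gt0]] := eqVneq a o.
  have bo : b != o by rewrite -ao eq_sym.
  by rewrite (negPf bo) ao => _ /andP[].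
rewrite (negPf bo) => /andP[co bc_gt0].
by apply: (@ccw_from_ccw o a b c); rewrite // eq_sym.
Qed.

End Order.

(** * Invariance under renumbering the vertices *)

Section Relabel.
Variables (R : realType) (N : nat).
Implicit Types (p : 'I_N -> 'rV[R]_2) (s : {perm 'I_N}) (t u : {set 'I_N}).
Implicit Types T : {set {set 'I_N}}.

Lemma hull_relabel p s t : hull p (s @: t) = hull (p \o s) t.
Proof.
have inj : {in t &, injective s} by move=> x y _ _; exact: perm_inj.
apply/seteqP; split=> X [w [w0 w1 ->]].
  exists (w \o s); split; first by move=> i; exact: w0.
    by rewrite -w1 big_imset.
  by rewrite big_imset.
exists (fun i => w ((s^-1)%g i)); split; first by move=> i; exact: w0.
  by rewrite big_imset //= -w1; apply: eq_bigr => i _; rewrite permK.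
by rewrite big_imset //=; apply: eq_bigr => i _; rewrite permK.
Qed.

Definition relabel s T : {set {set 'I_N}} := [set s @: t | t : {set 'I_N} in T].

Lemma imset_perm_inj s : injective (fun t => s @: t).
Proof. by apply: imset_inj; exact: perm_inj. Qed.

Lemma relabel_inj s : injective (relabel s).
Proof. by apply: imset_inj; exact: imset_perm_inj. Qed.

Lemma triangulation_relabel p s T :
  triangulation (p \o s) T -> triangulation p (relabel s T).
Proof.
move=> [T3 disj cover]; split.
- by move=> _ /imsetP[t tT ->]; rewrite card_imset ?T3 //; exact: perm_inj.
- move=> _ _ /imsetP[t tT ->] /imsetP[u uT ->] tu; rewrite !hull_relabel.
  by apply: disj => //; apply: contraNneq tu => ->.
- have sT : s @: [set: 'I_N]%SET = [set: 'I_N]%SET.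
    by apply/setP => i; rewrite inE -[i](permKV s) imset_f ?inE.
  move=> /cover; rewrite -[X in _ -> _ = hull p X]sT hull_relabel.
  move=> <-; apply/seteqP; split=> [X [_ /= /imsetP[t tT ->] tX]|X [t /= tT tX]].
    by exists t => //; rewrite -hull_relabel.
  by exists (s @: t); [exact: imset_f | rewrite hull_relabel].
Qed.

Lemma fair_relabel s T : fair T -> fair (relabel s T).
Proof.
move=> fairT black chk.
have card_class (c : {set 'I_N} -> bool) :
    #|[set t in relabel s T | c t]| = #|[set t in T | c (s @: t)]|.
  rewrite -[RHS](card_imset _ (@imset_perm_inj s)); congr #|pred_of_set _|; apply/setP => u.
  rewrite inE; apply/andP/imsetP => [[/imsetP[t tT ->] ct]|[t]].
    by exists t; rewrite ?inE ?tT.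
  by rewrite inE => /andP[tT ct] ->; split=> //; exact: imset_f.
rewrite !card_class; apply: fairT => t u tT uT tu.
apply: chk; rewrite ?imset_f // -imsetI ?card_imset //; first exact: perm_inj.
by move=> x y _ _; exact: perm_inj.
Qed.

Lemma leq_card_fair_relabel p s :
  (#|fair_triangulations (p \o s)| <= #|fair_triangulations p|)%N.
Proof.
rewrite -(card_imset _ (@relabel_inj s)); apply/subset_leq_card/subsetP => _ /imsetP[T + ->].
rewrite !inE => /asboolP[tT fT]; apply/asboolP.
by split; [exact: triangulation_relabel | exact: fair_relabel].
Qed.

(** The inequality for [s] and the one for its inverse. *)
Lemma card_fair_relabel p s :
  #|fair_triangulations (p \o s)| = #|fair_triangulations p|.
Proof.
apply/eqP; rewrite eqn_leq leq_card_fair_relabel /=.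
have {1}-> : p = (p \o s) \o (s^-1)%g by apply/funext => i /=; rewrite permKV.
exact: leq_card_fair_relabel.
Qed.

End Relabel.

Theorem theorem1p1 (R : realType) (n : nat) (p : 'I_(2 * n + 2) -> 'rV[R]_2)
    (p_convex : strictly_convex p) :
  (#|fair_triangulations p|%:R : rat) = 'C(2 * n, n)%:R ^+ 2 * (1 / (n%:R + 1)).
Proof.
rewrite -forests_diag -(size_btrees_rec (leqnn (n + n))) -/(btrees n n).
have [s ccw] := ccw_order p_convex; rewrite -(card_fair_relabel p s).
(* A general [N] allows substitution, as [2 * n + 2] and [(2 * n).+2] are equal but not
   convertible. *)
have count N (q : 'I_N -> 'rV[R]_2) : N = (2 * n).+2 ->
    (forall x y z : 'I_N, (x < y)%N -> (y < z)%N -> 0 < orient (q x) (q y) (q z)) ->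
    #|fair_triangulations q| = size (btrees n n).
  by move=> NE; subst N => ccwq; exact: card_fair_triangulations.
by rewrite (count _ _ (addn2 _) ccw).
Qed.
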